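(* Consider the oscillator network $\dot x_k = \mathrm{f}(x_k)+\varepsilon\sum_{j=1,j\neq k}^N\mathrm{g}(x_j,x_k)$, $x_k\in\mathbb{R}^d$, $k=1,\dots,N$, where $\dot x=\mathrm{f}(x)$ has an asymptotically stable limit cycle, for a coupling function $\mathrm{g}(x_j,x_k)=\tilde{\mathrm{g}}(x_j,x_k)\,v$ with a scalar function $\tilde{\mathrm{g}}:\mathbb{R}^d\times\mathbb{R}^d\to\mathbb{R}$ and $v\in\mathbb{R}^d$ fixed. If there is an interval $A\subset\mathbb{T}$ such that $v\in T_\vartheta$ for all $\vartheta\in A$, where $T_\vartheta$ is the tangent space of the isochron $\Theta_\vartheta$ at the point of the limit cycle with phase $\vartheta$, then the phase reduced system $\dot\theta_k=\omega+\varepsilon\sum_{j=1}^N\mathrm{g}^{\mathrm{PR}}(\theta_j,\theta_k)$ with phase interaction function $\mathrm{g}^{\mathrm{PR}}(\theta_j,\theta_k)$ has a dead zone $U\subset\mathbb{T}^2$ with $\mathbb{T}\times A\subset U$.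
   Context: $\mathbb{T}=\mathbb{R}/2\pi\mathbb{Z}$, $d>1$, and $\varepsilon$ is a small coupling strength. The limit cycle $\gamma(t)$ of $\dot x=\mathrm{f}(x)$ has minimal period $\tau>0$, $\omega=2\pi/\tau$ and $\Gamma=\{\gamma(t):t\in\mathbb{R}\}$. The asymptotic phase $\nu$ assigns to each $y_0$ in the basin of attraction of $\Gamma$ the $\psi\in\mathbb{T}$ such that $\|\gamma(\psi/\omega+t)-y(t)\|\to0$ as $t\to\infty$, where $y$ is the trajectory of $y_0$; $\nu^{-1}(\psi)$ denotes the point of $\Gamma$ with phase $\psi$. The isochron of $\vartheta\in\mathbb{T}$ is the $(d-1)$-dimensional level set $\Theta_\vartheta=\{x : \nu(x)=\vartheta\}$, and $T_\vartheta=\mathrm{T}_{\nu^{-1}(\vartheta)}\Theta_\vartheta$ is its tangent space (a linear subspace of $\mathbb{R}^d$) at $\nu^{-1}(\vartheta)$. The phase response curve is $Z(\vartheta)=\operatorname{grad}(\nu)|_{\nu^{-1}(\vartheta)}$. The phase interaction function $\mathrm{g}^{\mathrm{PR}}:\mathbb{T}^2\to\mathbb{R}$ is $\mathrm{g}^{\mathrm{PR}}(\theta_j,\theta_k)=\langle Z(\theta_k),\mathrm{g}(\nu^{-1}(\theta_j),\nu^{-1}(\theta_k))\rangle$, with $\langle\cdot,\cdot\rangle$ the usual scalar product on $\mathbb{R}^d$. A dead zone of the phase reduced system is a maximal connected open set $U\subset\mathbb{T}^2$ on which $\mathrm{g}^{\mathrm{PR}}$ vanishes identically.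
   Formalization: The interval A is taken to be a nonempty open interval of the circle (possibly all of it); for a closed interval with v tangent exactly on A, no open dead zone can contain T×A, so the claim fails there. *)

(* Defs.v *)
From HB Require Import structures.
From mathcomp Require Export all_boot all_order all_algebra.
From mathcomp Require Export all_classical all_reals all_analysis.

Set Implicit Arguments.
Unset Strict Implicit.
Unset Printing Implicit Defensive.

Import Order.TTheory GRing.Theory Num.Theory.
Import numFieldNormedType.Exports.

Local Open Scope classical_set_scope.
Local Open Scope ring_scope.
Local Open Scope quotient_scope.

Section circle.
Context {R : realType}.

Definition circle_rel (x y : R) : bool := (x - y) / (2 * pi) \is a Num.int.

Let circle_rel_refl : reflexive circle_rel.
Proof. by move=> x; rewrite /circle_rel subrr mul0r rpred0. Qed.

Let circle_rel_sym : symmetric circle_rel.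
Proof. by move=> x y; rewrite /circle_rel -opprB mulNr rpredN. Qed.

Let circle_rel_trans : transitive circle_rel.
Proof.
move=> y x z xy yz; rewrite /circle_rel.
by rewrite -[x - z](subrKA y) mulrDl rpredD.
Qed.

Canonical circle_equiv : equiv_rel R :=
  EquivRel circle_rel circle_rel_refl circle_rel_sym circle_rel_trans.

End circle.

(* R / 2 pi Z with the quotient topology *)
Definition circle (R : realType) : Type :=
  quotient_topology {eq_quot (@circle_equiv R)}.

HB.instance Definition _ (R : realType) := Quotient.on (circle R).
HB.instance Definition _ (R : realType) := Topological.on (circle R).

Definition to_circle {R : realType} (x : R) : circle R := \pi_(circle R) x.

(* All of the circle when b - a > 2 pi. *)
Definition open_arc {R : realType} (a b : R) : set (circle R) :=
  to_circle @` `]a, b[.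

Definition scalar {R : realType} {d : nat} (x y : 'rV[R]_d) : R :=
  \sum_(i < d) x 0 i * y 0 i.

Definition C1_at {R : realType} {V W : normedModType R} (f : V -> W) (x : V) :=
  \forall y \near x, differentiable f y /\
    forall u, {for y, continuous (fun z => 'D_u f z)}.

Section limit_cycle.
Context {R : realType} {d : nat}.
Implicit Types (f : 'rV[R]_d -> 'rV[R]_d) (gamma : R -> 'rV[R]_d) (tau : R).

(* The forward solution starting at y0, on [0, +oo[; the equation at 0 follows
   by continuity.  Norms on 'rV[R]_d are sup norms, which is immaterial for the
   notions below. *)
Definition trajectory f (y0 : 'rV[R]_d) (y : R -> 'rV[R]_d) :=
  [/\ y 0 = y0, {within `[0, +oo[, continuous y} &
      forall t : R, 0 < t -> is_derive t 1 y (f (y t))].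

Definition periodic_orbit f gamma tau :=
  [/\ forall t : R, is_derive t 1 gamma (f (gamma t)),
      0 < tau,
      forall t, gamma (t + tau) = gamma t &
      forall s, 0 < s -> s < tau -> exists t, gamma (t + s) <> gamma t].

(* Points at distance < e from the orbit. *)
Definition tube gamma (e : R) : set 'rV[R]_d :=
  [set x | exists s, `|x - gamma s| < e].

Definition basin f gamma : set 'rV[R]_d :=
  [set y0 | exists2 y, trajectory f y0 y &
     forall e : R, 0 < e -> \forall t \near +oo, tube gamma e (y t)].

Definition asymptotically_stable f gamma :=
  (forall e : R, 0 < e -> exists2 delta : R, 0 < delta &
     forall y0, tube gamma delta y0 ->
       exists2 y, trajectory f y0 y & forall t, 0 <= t -> tube gamma e (y t)) /\
  (exists2 delta : R, 0 < delta & tube gamma delta `<=` basin f gamma).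

Definition frequency tau : R := 2 * pi / tau.

(* As gamma is tau-periodic, the choice of the representative of psi is
   immaterial. *)
Definition has_phase f gamma tau (y0 : 'rV[R]_d) (psi : circle R) :=
  exists2 y, trajectory f y0 y &
    `|gamma (repr psi / frequency tau + t) - y t| @[t --> +oo] --> (0 : R).

Definition phase f gamma tau (y0 : 'rV[R]_d) : circle R :=
  xget (to_circle 0) [set psi | has_phase f gamma tau y0 psi].

Definition phase_inv f gamma tau (psi : circle R) : 'rV[R]_d :=
  xget (gamma 0) [set p | range gamma p /\ phase f gamma tau p = psi].

Definition isochron f gamma tau (theta : circle R) : set 'rV[R]_d :=
  [set x | basin f gamma x /\ phase f gamma tau x = theta].

(* Velocities at p of C^1 curves in S through p; when S is a C^1 submanifold
   near p this is the tangent space of S at p. *)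
Definition tangent_space (S : set 'rV[R]_d) (p : 'rV[R]_d) : set 'rV[R]_d :=
  [set v | exists c : R -> 'rV[R]_d,
     [/\ c 0 = p, C1_at c 0, \forall t \near (0 : R), S (c t) &
         is_derive (0 : R) 1 c v]].

Definition lift_near (nu : 'rV[R]_d -> circle R) (p : 'rV[R]_d)
    (h : 'rV[R]_d -> R) :=
  \forall x \near p, to_circle (h x) = nu x.

(* The gradient of a circle-valued map is that of a real-valued local lift; two
   lifts differentiable at p differ by a constant near p. *)
Definition circle_grad (nu : 'rV[R]_d -> circle R) (p : 'rV[R]_d) : 'rV[R]_d :=
  xget 0 [set z | exists h : 'rV[R]_d -> R,
    [/\ lift_near nu p h, differentiable h p &
        z = \row_(i < d) 'D_(delta_mx 0 i) h p]].

(* What the definitions of the isochrons, their tangent spaces and the phase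
   response curve presuppose: every point of the basin has an asymptotic phase,
   and the phase is C^1 near the cycle.  Since the derivative of the phase along
   the flow is frequency tau <> 0, its level sets are then (d-1)-dimensional
   C^1 submanifolds near the cycle. *)
Definition C1_phase f gamma tau :=
  (forall y0, basin f gamma y0 -> exists psi, has_phase f gamma tau y0 psi) /\
  (forall p, range gamma p -> exists2 h : 'rV[R]_d -> R,
     lift_near (phase f gamma tau) p h & C1_at h p).

Definition phase_response f gamma tau (theta : circle R) : 'rV[R]_d :=
  circle_grad (phase f gamma tau) (phase_inv f gamma tau theta).

End limit_cycle.

(* x_k' = f(x_k) + eps * \sum_(j != k) g(x_j, x_k), 0 <= k < size *)
Record network (R : realType) (d : nat) := Network {
  net_size : nat;
  net_strength : R;
  net_field : 'rV[R]_d -> 'rV[R]_d;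
  net_coupling : 'rV[R]_d -> 'rV[R]_d -> 'rV[R]_d }.

Definition network_rhs {R : realType} {d : nat} (S : network R d)
    (x : 'I_(net_size S) -> 'rV[R]_d) (k : 'I_(net_size S)) : 'rV[R]_d :=
  net_field S (x k) +
  net_strength S *: \sum_(j < net_size S | j != k) net_coupling S (x j) (x k).

(* theta_k' = omega + eps * \sum_j g(theta_j, theta_k), 0 <= k < size *)
Record phase_system (R : realType) := PhaseSystem {
  ph_size : nat;
  ph_strength : R;
  ph_frequency : R;
  ph_interaction : circle R -> circle R -> R }.

Definition phase_rhs {R : realType} (P : phase_system R)
    (theta : 'I_(ph_size P) -> circle R) (k : 'I_(ph_size P)) : R :=
  ph_frequency P +
  ph_strength P * \sum_(j < ph_size P) ph_interaction P (theta j) (theta k).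

Definition phase_interaction {R : realType} {d : nat} (S : network R d)
    (gamma : R -> 'rV[R]_d) (tau : R) (thj thk : circle R) : R :=
  let f := net_field S in
  scalar (phase_response f gamma tau thk)
         (net_coupling S (phase_inv f gamma tau thj)
                         (phase_inv f gamma tau thk)).

Definition phase_reduction {R : realType} {d : nat} (S : network R d)
    (gamma : R -> 'rV[R]_d) (tau : R) : phase_system R :=
  PhaseSystem (net_size S) (net_strength S) (frequency tau)
    (phase_interaction S gamma tau).

Definition null_region {R : realType} (P : phase_system R)
    (U : set (circle R * circle R)) :=
  [/\ open U, connected U, U !=set0 &
      forall th, U th -> ph_interaction P th.1 th.2 = 0].

Definition dead_zone {R : realType} (P : phase_system R)
    (U : set (circle R * circle R)) :=
  null_region P U /\ forall V, null_region P V -> U `<=` V -> V = U.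

(* Main.v *)
(** On an isochron the phase is constant.  A continuous real lift of the phase
therefore moves by multiples of [2 pi] along any curve in the isochron, hence is
constant near the base point, and the chain rule makes the phase response curve
orthogonal to the tangent space of the isochron.  So the interaction function
vanishes on the strip over the arc.  The strip is open and connected, and the
dead zone containing it is the union of all the null regions containing it. *)

Require Import Defs.

Import Order.TTheory GRing.Theory Num.Theory.
Import numFieldNormedType.Exports.
Local Open Scope classical_set_scope.
Local Open Scope ring_scope.

(** The product is a union of crosses: [cross y] joins the horizontal slice at height [y] to the
    vertical slice over the fixed [x0]. The two slices meet at [(x0, y)], and all crosses share
    [(x0, y0)]. *)
Lemma connectedX (X Y : topologicalType) (A : set X) (B : set Y) :
  connected A -> connected B -> connected (A `*` B).
Proof.
move=> cA cB.
have [->|/set0P[[x0 y0] [/= Ax0 By0]]] := eqVneq (A `*` B) set0.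
  exact: connected0.
pose cross y := (fun x => (x, y)) @` A `|` (fun y => (x0, y)) @` B.
have -> : A `*` B = \bigcup_(y in B) cross y.
  apply/seteqP; split => [[x y] [/= Ax By]|p [y By [[x Ax <-]|[z Bz <-]]]] //.
  by exists y => //; left; exists x.
have pairl (y : Y) : continuous (fun x : X => (x, y)).
  by move=> x; apply: cvg_pair; [exact: cvg_id|exact: cvg_cst].
have pairr (x : X) : continuous (fun y : Y => (x, y)).
  by move=> y; apply: cvg_pair; [exact: cvg_cst|exact: cvg_id].
apply: bigcup_connected => [|y By].
  by exists (x0, y0) => y By; right; exists y0.
apply: connectedU.
- by exists (x0, y); split; [exists x0|exists y].
- exact/connected_continuous_connected/continuous_subspaceT/pairl.
- exact/connected_continuous_connected/continuous_subspaceT/pairr.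
Qed.

Section circle.
Context {R : realType}.

Lemma to_circleP (x y : R) :
  to_circle x = to_circle y <-> (x - y) / (2 * pi) \is a Num.int.
Proof.
by split=> [/(@eqmodP _ circle_equiv)|xy] //; apply/(@eqmodP _ circle_equiv).
Qed.

Lemma to_circle_continuous : continuous (@to_circle R).
Proof. exact: pi_continuous. Qed.

(** Two representatives of one class differ by an integer multiple of [2 * pi], so distinct ones are
    at least [2 * pi] apart. *)
Lemma to_circle_near_inj (x : R) :
  \forall y \near x, to_circle y = to_circle x -> y = x.
Proof.
have pi2 : 0 < 2 * pi :> R by rewrite mulr_gt0 ?pi_gt0.
exists (2 * pi) => //= y /=; rewrite distrC => yx /to_circleP yxZ.
apply/eqP; rewrite -subr_eq0; apply: contraTT yx => yx0; rewrite -leNgt.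
have := norm_intr_ge1 yxZ; have -> : (y - x) / (2 * pi) != 0.
  by rewrite mulf_neq0 ?invr_neq0 ?(lt0r_neq0 pi2).
move=> /(_ isT).
by rewrite normrM normfV (gtr0_norm pi2) ler_pdivlMr// mul1r.
Qed.

Lemma open_arc_open (a b : R) : open (open_arc a b).
Proof.
have pi20 : 2 * pi != 0 :> R by rewrite gt_eqF// mulr_gt0 ?pi_gt0.
(* By definition of the quotient topology it suffices that the preimage is open; it is the union of
   the translates of []a, b[] by multiples of [2 * pi]. *)
suff : open (@to_circle R @^-1` open_arc a b) by [].
have -> : @to_circle R @^-1` open_arc a b =
    \bigcup_(k : int) ((fun x => x + k%:~R * (2 * pi)) @^-1` `]a, b[).
  apply/seteqP; split => [x [y yab /to_circleP /intrP[k yx]]|x [k _ xab]].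
    exists k => //=; suff -> : x + k%:~R * (2 * pi) = y by [].
    by rewrite -yx mulfVK// addrC subrK.
  exists (x + k%:~R * (2 * pi)) => //; apply/to_circleP.
  by rewrite addrAC subrr add0r mulfK// intr_int.
apply: bigcup_open => k _; apply: open_comp => [x _|].
  by apply: cvgD; [exact: cvg_id|exact: cvg_cst].
exact: interval_open.
Qed.

Lemma open_arc_connected (a b : R) : connected (open_arc a b).
Proof.
apply: connected_continuous_connected.
  exact/connected_intervalP/interval_is_interval.
exact/continuous_subspaceT/to_circle_continuous.
Qed.

Lemma circle_connected : connected [set: circle R].
Proof.
have -> : [set: circle R] = @to_circle R @` setT.
  by apply/seteqP; split => // x _; exists (repr x) => //; exact: reprK.
apply: connected_continuous_connected.
  by apply/connected_intervalP => x y _ _ z _.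
exact/continuous_subspaceT/to_circle_continuous.
Qed.

End circle.

Lemma derive_lift_level_curve (R : realType) (d : nat)
    (nu : 'rV[R]_d -> circle R) (h : 'rV[R]_d -> R) (c : R -> 'rV[R]_d)
    (v : 'rV[R]_d) (theta : circle R) :
  lift_near nu (c 0) h -> differentiable h (c 0) ->
  (\forall t \near (0 : R), nu (c t) = theta) ->
  is_derive (0 : R) 1 c v -> 'D_v h (c 0) = 0.
Proof.
move=> hnu dh cth [/derivable1_diffP dc <-].
have cc : {for 0, continuous c} by exact: differentiable_continuous.
have chc : {for 0, continuous (h \o c)}.
  by apply: continuous_comp cc _; exact: differentiable_continuous.
have hc0 : \forall t \near (0 : R), (h \o c) t = cst (h (c 0)) t.
  have near_lift := cc _ hnu.
  have near_inj := chc _ (to_circle_near_inj (h (c 0))).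
  near=> t; rewrite /=.
  have : to_circle (h (c t)) = to_circle (h (c 0)).
    (* Both local hypotheses hold at the base point itself, so the class of [h (c 0)] is [theta]. *)
    rewrite (nbhs_singleton hnu) (nbhs_singleton cth).
    have -> : to_circle (h (c t)) = nu (c t) by near: t; exact: near_lift.
    by near: t.
  by near: t; exact: near_inj.
have : 'D_1 (h \o c) 0 = 'D_1 (cst (h (c 0))) (0 : R) by exact: near_eq_derive.
rewrite derive_cst deriveE; last first.
  exact: differentiable_comp.
by rewrite diff_comp //= !deriveE.
Unshelve. all: by end_near. Qed.

Lemma scalar_jacobian (R : realType) (d : nat) (h : 'rV[R]_d -> R)
    (p v : 'rV[R]_d) :
  differentiable h p ->
  scalar (\row_(i < d) 'D_(delta_mx 0 i) h p) v = 'D_v h p.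
Proof.
move=> dh; rewrite deriveE// [in RHS](row_sum_delta v) linear_sum.
by apply: eq_bigr => i _; rewrite linearZ mxE deriveE// mulrC.
Qed.

Section phase.
Context {R : realType} {d : nat}.
Context (f : 'rV[R]_d -> 'rV[R]_d) (gamma : R -> 'rV[R]_d) (tau : R).

(** The default value [gamma 0] of [xget] also lies on the orbit, so [C1_phase] supplies a lift at
    every point [phase_inv]. *)
Lemma phase_inv_range (theta : circle R) :
  range gamma (phase_inv f gamma tau theta).
Proof.
by rewrite /phase_inv; case: xgetP => [p _ []|_] //; exists 0.
Qed.

Lemma phase_response_tangent (v : 'rV[R]_d) (theta : circle R) :
  C1_phase f gamma tau ->
  tangent_space (isochron f gamma tau theta) (phase_inv f gamma tau theta) v ->
  scalar (phase_response f gamma tau theta) v = 0.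
Proof.
move=> [_ /(_ _ (phase_inv_range theta))[h hlift /nbhs_singleton[dh _]]].
rewrite /phase_response /circle_grad => -[c [c0 _ cS dc]].
(* The gradient is taken from some lift [h'], possibly other than [h]; the lift [h] rules out the
   default value of [xget]. *)
case: xgetP => [z _ [h' [h'lift dh' ->]]|noz]; last first.
  exfalso; pose p := phase_inv f gamma tau theta.
  by apply: (noz (\row_i 'D_(delta_mx 0 i) h p)); exists h.
rewrite scalar_jacobian//; move: h'lift dh'; rewrite -c0 => h'lift dh'.
apply: (@derive_lift_level_curve _ _ _ _ _ _ theta h'lift dh' _ dc).
by apply: filterS cS => t [].
Qed.

End phase.

(** The union of all null regions containing [W] is connected since they share a point of [W]. It is
    maximal since a null region containing it also contains [W], hence is one of its members. *)
Lemma dead_zone_exists (R : realType) (P : phase_system R)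
    (W : set (circle R * circle R)) :
  null_region P W -> exists U, dead_zone P U /\ W `<=` U.
Proof.
move=> nW; pose F := [set V | null_region P V /\ W `<=` V].
have WF : F W by split.
have [_ _ [w Ww] _] := nW.
have nU : null_region P (\bigcup_(V in F) V).
  split.
  - by apply: bigcup_open => V [[]].
  - apply: bigcup_connected => [|V [[]]//].
    by exists w => V [_]; exact.
  - by exists w, W.
  - by move=> th [V [[_ _ _ V0] _]]; exact: V0.
exists (\bigcup_(V in F) V); split; last by move=> x Wx; exists W.
split=> // V nV UV; apply/seteqP; split=> // x Vx.
by exists V => //; split=> // y Wy; apply: UV; exists W.
Qed.

Theorem proposition1 (R : realType) (d : nat) (hd : (1 < d)%N)
  (N : nat) (eps : R)
  (f : 'rV[R]_d -> 'rV[R]_d) (gt : 'rV[R]_d -> 'rV[R]_d -> R) (v : 'rV[R]_d)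
  (gamma : R -> 'rV[R]_d) (tau : R)
  (hf : forall x, C1_at f x)
  (hgamma : periodic_orbit f gamma tau)
  (hstable : asymptotically_stable f gamma)
  (hphase : C1_phase f gamma tau)
  (a b : R) (hab : a < b)
  (hv : forall theta, open_arc a b theta ->
     tangent_space (isochron f gamma tau theta)
       (phase_inv f gamma tau theta) v) :
  exists U : set (circle R * circle R),
    dead_zone (phase_reduction
      (Network N eps f (fun xj xk => gt xj xk *: v)) gamma tau) U /\
    [set: circle R] `*` open_arc a b `<=` U.
Proof.
apply: dead_zone_exists; split.
- have -> : [set: circle R] `*` open_arc a b = snd @^-1` open_arc a b.
    by apply/seteqP; split => [x []|x].
  by apply: open_comp (open_arc_open _ _) => x _; exact: cvg_snd.
- exact: connectedX circle_connected (open_arc_connected _ _).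
- exists (to_circle a, to_circle ((a + b) / 2)); split=> //=.
  by exists ((a + b) / 2) => //=; rewrite in_itv/= !midf_lt.
- move=> [thj thk] [_ /= /hv vT]; rewrite /phase_interaction /= /scalar.
  (* The scalar factor [gt] comes out of the sum, which leaves the pairing of the phase response
     with the fixed direction [v]. *)
  under eq_bigr do rewrite mxE mulrCA.
  rewrite -mulr_sumr -/(scalar _ v).
  by rewrite phase_response_tangent// mulr0.
Qed.
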